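(* Let $A$ be a proper unital $*$-ring such that $A_\Sigma\cap-A_\Sigma=\{0\}$ and $A_+A_+\cap A_{\mathrm{sa}}=A_+$. Then decompositions of self-adjoint elements are unique: if $a,b,c,d\in A_+$ satisfy $ab=0$, $cd=0$ and $a-b=c-d$, then $a=c$ and $b=d$.
   Context: A $*$-ring is an associative ring with a map $a\mapsto a^*$ satisfying $a^{**}=a$, $(ab)^*=b^*a^*$, $(a+b)^*=a^*+b^*$; it is proper if $a^*a=0$ implies $a=0$. Unital means having a two-sided unit $1$. $A_{\mathrm{sa}}=\{a\in A:a=a^*\}$. $A_\Sigma$ is the set of all finite sums $\sum_{k=1}^n a_k^*a_k$ with $n\geq1$, $a_k\in A$. $A_+=\{a\in A:na\in A_\Sigma\text{ for some positive integer }n\}$. $A_+A_+=\{ab:a,b\in A_+\}$. A decomposition of $c\in A_{\mathrm{sa}}$ is a pair $a,b\in A_+$ with $ab=0$ and $c=a-b$. *)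

(* Defs.v *)
From HB Require Import structures.
From mathcomp Require Import all_boot all_algebra.
From mathcomp Require Import classical_sets.

Set Implicit Arguments.
Unset Strict Implicit.
Unset Printing Implicit Defensive.

Import GRing.Theory.
Local Open Scope classical_set_scope.
Local Open Scope ring_scope.

(* Unital *-rings; the base is pzRingType, so the zero ring is allowed. *)
HB.mixin Record PzRing_hasStar A of GRing.PzRing A := {
  star : A -> A;
  starK : involutive star;
  starM : forall a b : A, star (a * b) = star b * star a;
  starD : forall a b : A, star (a + b) = star a + star b
}.

#[short(type="starRingType")]
HB.structure Definition StarRing := {A of GRing.PzRing A & PzRing_hasStar A}.

Definition star_proper (A : starRingType) : Prop :=
  forall a : A, star a * a = 0 -> a = 0.

Definition star_sa (A : starRingType) : set A := [set a | a = star a].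
Arguments star_sa A : clear implicits.

Definition star_sum (A : starRingType) : set A :=
  [set s | exists (n : nat) (a : 'I_n -> A),
      (0 < n)%N /\ s = \sum_(k < n) star (a k) * a k].
Arguments star_sum A : clear implicits.

Definition star_pos (A : starRingType) : set A :=
  [set a | exists n : nat, (0 < n)%N /\ star_sum A (a *+ n)].
Arguments star_pos A : clear implicits.

(* Main.v *)
Require Import Defs.
From HB Require Import structures.
From mathcomp Require Import all_boot all_algebra.
From mathcomp Require Import classical_sets.

Set Implicit Arguments.
Unset Strict Implicit.
Unset Printing Implicit Defensive.

Import GRing.Theory.
Local Open Scope classical_set_scope.
Local Open Scope ring_scope.

(** Put [h := a - c = b - d] and [s := a + b + c + d].  Since [a b = 0] and
    [c d = 0], both [(a + b) ^+ 2] and [(c + d) ^+ 2] are the square of the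
    common difference [a - b = c - d]; two elements with equal squares have
    a difference, here [2 h], that anticommutes with their sum [s], and so
    does [h] ([orthogonal_differences_anticommute]).  Hence [h ^+ 2]
    commutes with [s], so the hypothesis on products makes [h ^+ 2 * s]
    positive.  But [h * s * h = - (h ^+ 2 * s)] is positive too, being a
    conjugate of [s]; as the positive cone is pointed ([star_pos_addr_eq0]),
    [h * s * h = 0], and pointedness again kills each of the summands
    [h * a * h] and [h * c * h].  Properness then gives [a * h = c * h = 0]
    ([star_pos_conj_eq0]), whence [h * h = (a - c) * h = 0] and [h = 0].

    The cone [star_pos] consists of elements some multiple of which is a sum
    of squares, so these arguments also need the ring to be torsion-free;
    this follows from pointedness and properness ([star_torsion_free]). *)

Section SumsOfSquares.
Context {A : starRingType}.
Implicit Types (x y s u v : A).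

Lemma star0 : star (0 : A) = 0.
Proof. by apply: (addrI (star 0)); rewrite -starD !addr0. Qed.

Lemma starN x : star (- x) = - star x.
Proof. by apply/eqP; rewrite -addr_eq0 -starD addNr star0. Qed.

Lemma star_sum_square x : star_sum A (star x * x).
Proof. by exists 1, (fun=> x); rewrite big_ord1. Qed.

Lemma star_sum0 : star_sum A 0.
Proof. by have := star_sum_square 0; rewrite mulr0. Qed.

Lemma star_sumD u v : star_sum A u -> star_sum A v -> star_sum A (u + v).
Proof.
move=> [m [f [m0 ->]]] [n [g [n0 ->]]].
exists (m + n)%N, (fun k => match split k with inl i => f i | inr j => g j end).
split; first by rewrite addn_gt0 m0.
rewrite big_split_ord; congr (_ + _); apply: eq_bigr => i _.
- by rewrite (unsplitK (inl i)).
- by rewrite (unsplitK (inr i)).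
Qed.

Lemma star_sumMn u n : star_sum A u -> star_sum A (u *+ n).
Proof.
move=> hu; elim: n => [|n IHn]; first by rewrite mulr0n; exact: star_sum0.
by rewrite mulrS; exact: star_sumD.
Qed.

Lemma star_sum_conj x u : star_sum A u -> star_sum A (star x * u * x).
Proof.
move=> [n [f [n0 ->]]]; exists n, (fun k => f k * x); split=> //.
rewrite mulr_sumr mulr_suml; apply: eq_bigr => k _.
by rewrite starM !mulrA.
Qed.

Lemma star_posD u v : star_pos A u -> star_pos A v -> star_pos A (u + v).
Proof.
move=> [m [m0 hu]] [n [n0 hv]]; exists (m * n)%N; rewrite muln_gt0 m0 n0.
split=> //; rewrite mulrnDl mulrnA [in v *+ _]mulnC mulrnA.
by apply: star_sumD; exact: star_sumMn.
Qed.

Lemma star_pos_conj x u : star_pos A u -> star_pos A (star x * u * x).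
Proof.
move=> [n [n0 hu]]; exists n; split=> //.
by rewrite -mulrnAl -mulrnAr; exact: star_sum_conj.
Qed.

Lemma star_pos_square x : star_pos A (star x * x).
Proof. by exists 1; split=> //; exact: star_sum_square. Qed.

End SumsOfSquares.

Section PointedCone.
Context {A : starRingType}.
Hypothesis hproper : star_proper A.
Hypothesis hsum : star_sum A `&` [set - s | s in star_sum A] = [set 0].
Implicit Types (x y s u v : A).

Lemma star_sum_addr_eq0 u v :
  star_sum A u -> star_sum A v -> u + v = 0 -> u = 0.
Proof.
move=> hu hv /eqP; rewrite addr_eq0 => /eqP uE.
suff: [set 0] u by [].
by rewrite -hsum; split=> //; exists v.
Qed.

Lemma sum_squares_eq0 n (f : 'I_n -> A) :
  \sum_(k < n) star (f k) * f k = 0 -> forall k, f k = 0.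
Proof.
move=> f0 k; apply: hproper.
move: f0; rewrite (bigD1 k) //=; apply: star_sum_addr_eq0.
  exact: star_sum_square.
apply: big_ind => [||i _]; [exact: star_sum0 | exact: star_sumD |].
exact: star_sum_square.
Qed.

(** If [x *+ n = 0], then the sum of [n] copies of [star x * x] vanishes. *)
Lemma star_torsion_free n x : (0 < n)%N -> x *+ n = 0 -> x = 0.
Proof.
move=> n0 nx0; apply: (@sum_squares_eq0 n (fun=> x) _ (Ordinal n0)).
by rewrite sumr_const card_ord -mulrnAr nx0 mulr0.
Qed.

Lemma star_pos_addr_eq0 u v :
  star_pos A u -> star_pos A v -> u + v = 0 -> u = 0.
Proof.
move=> [m [m0 hu]] [n [n0 hv]] uv0.
apply: (@star_torsion_free (m * n)%N); first by rewrite muln_gt0 m0.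
apply: (@star_sum_addr_eq0 _ (v *+ (m * n))).
- by rewrite mulrnA; exact: star_sumMn.
- by rewrite mulnC mulrnA; exact: star_sumMn.
- by rewrite -mulrnDl uv0 mul0rn.
Qed.

(** A multiple of the conjugate is the sum of the squares of the [f k * x],
    where the squares of the [f k] add up to a multiple of [u]. *)
Lemma star_pos_conj_eq0 x u : star_pos A u -> star x * u * x = 0 -> u * x = 0.
Proof.
move=> [n [n0 [m [f [_ uE]]]]] xux0; apply: (star_torsion_free n0).
have fx0 : forall k, f k * x = 0.
  apply: (@sum_squares_eq0 _ (fun k => f k * x)).
  transitivity (star x * (u *+ n) * x).
    rewrite uE mulr_sumr mulr_suml; apply: eq_bigr => k _.
    by rewrite starM !mulrA.
  by rewrite mulrnAr mulrnAl xux0 mul0rn.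
rewrite -mulrnAl uE mulr_suml big1 // => k _.
by rewrite -mulrA fx0 mulr0.
Qed.

End PointedCone.

(** Multiplying [a - b = c - d] by [a] and by [c], on either side, gives
    [a * a + a * d = a * c = c * c + b * c] and
    [a * a + d * a = c * a = c * c + c * b]; hence
    [(a - c) * (a + b + c + d) = 2 (a * c - c * a)], and the product in the
    other order is the opposite.  For [p := a + b] and [q := c + d], where
    [p - q = 2 (a - c)], doubling the conclusion gives
    [(p - q) * (p + q) + (p + q) * (p - q) = 0], that is
    [2 (p * p - q * q) = 0]; going through the cross terms avoids having to
    cancel 2. *)
Lemma orthogonal_differences_anticommute (R : pzRingType) (a b c d : R) :
  a * b = 0 -> b * a = 0 -> c * d = 0 -> d * c = 0 -> a - b = c - d ->
  (a - c) * (a + b + c + d) = - ((a + b + c + d) * (a - c)).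
Proof.
move=> ab0 ba0 cd0 dc0 abcd.
have aa_ad : a * a + a * d = a * c.
  by apply/eqP; rewrite eq_sym -subr_eq -mulrBr -abcd mulrBr ab0 subr0.
have aa_da : a * a + d * a = c * a.
  by apply/eqP; rewrite eq_sym -subr_eq -mulrBl -abcd mulrBl ba0 subr0.
have cb_cc : c * b + c * c = c * a.
  by apply/eqP; rewrite addrC eq_sym -subr_eq -mulrBr abcd mulrBr cd0 subr0.
have bc_cc : b * c + c * c = a * c.
  by apply/eqP; rewrite addrC eq_sym -subr_eq -mulrBl abcd mulrBl dc0 subr0.
rewrite mulrBl mulrBr !mulrDr !mulrDl ab0 ba0 cd0 dc0 !addr0.
rewrite [a * a + _ + _]addrAC aa_ad [a * a + _ + _]addrAC aa_da.
by rewrite -[c * a + c * b + _]addrA cb_cc -[a * c + b * c + _]addrA bc_cc opprB.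
Qed.

Theorem theorem1 (A : starRingType) (hproper : star_proper A)
  (hsum : star_sum A `&` [set - s | s in star_sum A] = [set 0])
  (hprod : [set a * b | a in star_pos A & b in star_pos A] `&` star_sa A
           = star_pos A)
  (a b c d : A) (ha : star_pos A a) (hb : star_pos A b)
  (hc : star_pos A c) (hd : star_pos A d)
  (hab : a * b = 0) (hcd : c * d = 0) (habcd : a - b = c - d) :
  a = c /\ b = d.
Proof.
have pos_sa x : star_pos A x -> star x = x by rewrite -hprod => -[_ <-].
have comm0 x y : star_pos A x -> star_pos A y -> x * y = 0 -> y * x = 0.
  by move=> /pos_sa xE /pos_sa yE xy0; rewrite -xE -yE -starM xy0 star0.
pose h := a - c; pose s := a + b + c + d.
have hE : star h = h by rewrite starD starN !pos_sa.
have sP : star_pos A s by do !apply: star_posD.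
have anti : h * s = - (s * h).
  exact: (orthogonal_differences_anticommute hab (comm0 _ _ ha hb hab)
            hcd (comm0 _ _ hc hd hcd) habcd).
have hhs : h * h * s = s * (h * h).
  by rewrite -(mulrA h h s) anti mulrN (mulrA h s h) anti mulNr opprK -mulrA.
have hhsP : star_pos A (h * h * s).
  rewrite -hprod; split.
    exists (h * h); last by exists s.
    by rewrite -[X in X * h]hE; exact: star_pos_square.
  by rewrite /star_sa /= !starM hE (pos_sa _ sP) hhs.
have conjP x : star_pos A x -> star_pos A (h * x * h).
  by rewrite -[X in X * x]hE; exact: star_pos_conj.
have hsh0 : h * s * h = 0.
  apply: (star_pos_addr_eq0 hproper hsum (conjP _ sP) hhsP).
  by rewrite anti mulNr -(mulrA s h h) hhs addNr.
have killed x y : star_pos A x -> star_pos A y -> x + y = s -> x * h = 0.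
  move=> xP yP xyE; apply: (star_pos_conj_eq0 hproper hsum xP); rewrite hE.
  apply: (star_pos_addr_eq0 hproper hsum (conjP _ xP) (conjP _ yP)).
  by rewrite -mulrDl -mulrDr xyE.
have ah0 : a * h = 0.
  apply: (killed _ (b + c + d)) => //; first by do !apply: star_posD.
  by rewrite /s !addrA.
have ch0 : c * h = 0.
  apply: (killed _ (a + b + d)) => //; first by do !apply: star_posD.
  by rewrite /s addrCA !addrA addrAC.
have h0 : h = 0.
  by apply: hproper; rewrite hE {1}/h mulrBl ah0 ch0 subr0.
have ac : a = c by apply/eqP; rewrite -subr_eq0 -/h h0.
by split=> //; move: habcd; rewrite ac => /addrI /oppr_inj.
Qed.
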